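(* Let $G=(V,E)$ be a transitive graph of polynomial growth with dimension $d=2$, let $J:V\times V\to[0,\infty)$ be transitive and integrable, and suppose that $J(x,y)=O(d_G(x,y)^{-d\alpha})$ with $\alpha\ge2$. Let $\beta>\beta_c$. Then the infinite cluster $K_\infty$ is recurrent almost surely.
   Context: Graphs are infinite, connected, locally finite and simple. $G=(V,E)$ is transitive if its automorphism group acts transitively on $V$; $o$ is a fixed origin, $d_G$ the graph metric, $B(r)=\{x: d_G(o,x)\le r\}$, and $\#S$ is the cardinality of a set $S$. A transitive graph of polynomial growth has a unique positive integer $d=\dim(G)$, its dimension, for which there are $c_G,C_G>0$ with $c_Gr^d\le \#B(r)\le C_Gr^d$ for all $r\in\mathbb N=\{1,2,\dots\}$. A kernel $J:V\times V\to[0,\infty)$ is symmetric, and it is transitive if $J(\gamma x,\gamma y)=J(x,y)$ for every graph automorphism $\gamma$. It is integrable if $\sum_{x\in V\setminus\{o\}}J(o,x)<\infty$. $J(x,y)=O(d_G(x,y)^{-d\alpha})$ means there are $C_J,R_J>0$ with $J(x,y)\le C_Jd_G(x,y)^{-d\alpha}$ whenever $d_G(x,y)\ge R_J$. Long-range percolation on $G$ with kernel $J$ and parameter $\beta\ge0$ is the random graph with vertex set $V$ in which each unordered pair of distinct vertices $\{x,y\}$ is an edge independently with probability $1-\exp(-\beta J(x,y))$. Its law is $\mathbf P_\beta$; its connected components are clusters; $K$ is the cluster of $o$; $\beta_c=\inf\{\beta\ge0:\mathbf P_\beta(\#K=\infty)>0\}$; for $\beta>\beta_c$, $K_\infty$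 is the infinite cluster, a graph with the open edges (if there is more than one infinite cluster, the statement concerns each of them). $K_\infty$ is transient if the simple random walk on it is transient, and recurrent otherwise. *)

(* Defs.v *)
From mathcomp Require Import all_boot all_order all_algebra finmap.
From mathcomp Require Import all_classical all_reals all_analysis.
Set Implicit Arguments.
Unset Strict Implicit.
Unset Printing Implicit Defensive.
Import Order.TTheory GRing.Theory Num.Theory.
Local Open Scope classical_set_scope.
Local Open Scope ring_scope.

Section Graphs.
Context {V : choiceType}.
Implicit Types (e : rel V) (x y : V).

Definition simple_graph e := symmetric e /\ irreflexive e.

Definition neighbours e x : set V := [set y | e x y].

Definition locally_finite e := forall x, finite_set (neighbours e x).

Definition walk_lengths e x y : set nat :=
  [set n | exists2 p : seq V, path e x p & last x p = y /\ size p = n].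

Definition joined e x y := walk_lengths e x y !=set0.

Definition connected_graph e := forall x y, joined e x y.

(* Least length of a walk from x to y; the default 0 is only reached when x
   and y are not joined. *)
Definition gdist e x y : nat :=
  xget 0%N [set n | walk_lengths e x y n /\
                    forall m, walk_lengths e x y m -> (n <= m)%N].

Definition gball e x (r : nat) : set V := [set y | (gdist e x y <= r)%N].

Definition automorphism e (g : V -> V) :=
  bijective g /\ forall x y, e (g x) (g y) = e x y.

Definition transitive_graph e :=
  forall x y, exists2 g, automorphism e g & g x = y.

Definition component e x : set V := [set y | joined e x y].

(* The subgraph of e spanned by C; vertices outside C become isolated. *)
Definition induced e (C : set V) : rel V :=
  fun x y => [&& x \in C, y \in C & e x y].

End Graphs.

(* fset_set is fset0 on infinite sets; it is only meant for finite balls, which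
   all balls of a locally finite graph are. *)
Definition growth_dimension (R : realType) (V : choiceType) (e : rel V) (o : V)
    (d : nat) :=
  exists c C : R, [/\ 0 < c, 0 < C &
    forall r : nat, (1 <= r)%N ->
      c * r%:R ^+ d <= (#|` fset_set (gball e o r)|)%:R <= C * r%:R ^+ d].

Section Kernels.
Context {R : realType} {V : choiceType}.
Implicit Types (e : rel V) (J : V -> V -> R).

Definition kernel_ge0 J := forall x y, 0 <= J x y.

Definition kernel_symmetric J := forall x y, J x y = J y x.

Definition kernel_transitive e J :=
  forall g, automorphism e g -> forall x y, J (g x) (g y) = J x y.

Definition kernel_integrable (o : V) J :=
  (\esum_(x in [set x | x <> o]) (J o x)%:E < +oo)%E.

Definition kernel_bigO e J (s : R) :=
  exists C r : R, [/\ 0 < C, 0 < r & forall x y,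
    r <= (gdist e x y)%:R -> J x y <= C * (gdist e x y)%:R `^ (- s)].

End Kernels.

Section Percolation.
Context {V : choiceType}.

Definition upair := {a : {fset V} | #|` a| == 2%N}.

(* Configurations {0,1}^upair with the product sigma-algebra. *)
Definition open_cylinders : set (set (upair -> bool)) :=
  [set [set w : upair -> bool | w a] | a in [set: upair]].

Definition config := g_sigma_algebraType open_cylinders.

(* The random graph of a configuration. When x = y, [fset x; y] is not an
   upair and the value is false, so there are no loops. *)
Definition open_graph (w : config) : rel V :=
  fun x y => if insub [fset x; y]%fset is Some a then w a else false.

Section Law.
Context {R : realType}.

Definition percolation_law (J : V -> V -> R) (beta : R)
    (P : probability config R) :=
  (forall x y, x != y ->
     P [set w : config | open_graph w x y] = (1 - expR (- (beta * J x y)))%:E) /\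
  (forall S : {fset upair},
     P [set w : config | forall a, a \in S -> w a] =
     (\prod_(a <- S) P [set w : config | w a])%E).

(* An extended real: it is +oo when no parameter percolates. *)
Definition critical_parameter (P : R -> probability config R) (o : V) : \bar R :=
  ereal_inf [set b%:E | b in [set b : R | 0 <= b /\
    (0 < P b [set w | infinite_set (component (open_graph w) o)])%E]].

End Law.
End Percolation.
Arguments upair : clear implicits.
Arguments config : clear implicits.

Section RandomWalk.
Context {R : realType} {V : choiceType}.

Definition srw_step (e : rel V) (x y : V) : R :=
  if e x y then (#|` fset_set (neighbours e x)|)%:R^-1 else 0.

(* X is a simple random walk on e started from v: the last clause is the Markov
   property with transition matrix srw_step, cleared of its conditional
   probability so that it also makes sense for null histories. *)
Definition simple_random_walk (e : rel V) (v : V) (d : measure_display)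
    (T : measurableType d) (Q : probability T R) (X : nat -> T -> V) :=
  [/\ forall n x, measurable [set t | X n t = x],
      Q [set t | X 0%N t = v] = 1%E &
      forall (n : nat) (x : nat -> V),
        Q [set t | forall i, (i <= n.+1)%N -> X i t = x i] =
        (Q [set t | forall i, (i <= n)%N -> X i t = x i] *
         (srw_step e (x n) (x n.+1))%:E)%E].

Definition transient_from (e : rel V) (v : V) :=
  exists (d : measure_display) (T : measurableType d) (Q : probability T R)
         (X : nat -> T -> V),
    simple_random_walk e v Q X /\
    (Q [set t | exists2 n, (0 < n)%N & X n t = v] < 1)%E.

(* (C, induced e C) is meant to be a connected component of e, so that
   transience does not depend on the starting vertex. *)
Definition transient_on (e : rel V) (C : set V) :=
  exists2 v, C v & transient_from (induced e C) v.

Definition recurrent_on (e : rel V) (C : set V) := ~ transient_on e C.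

End RandomWalk.
Arguments transient_from R {V} e v.
Arguments transient_on R {V} e C.
Arguments recurrent_on R {V} e C.

(* Main.v *)
Require Import Defs.
From mathcomp Require Import all_boot all_order all_algebra finmap.
From mathcomp Require Import all_classical all_reals all_analysis.
From mathcomp Require Import measurable_realfun.
From mathcomp Require Import ring lra zify.
Set Implicit Arguments.
Unset Strict Implicit.
Unset Printing Implicit Defensive.
Import Order.TTheory GRing.Theory Num.Theory.
Import numFieldNormedType.Exports.
Local Open Scope classical_set_scope.
Local Open Scope ring_scope.

(** A graph is recurrent as soon as there are finitely supported functions,
equal to 1 at a given vertex, whose Dirichlet energies tend to 0.  The energy
is linear in the edge weights, and an edge xy is open with probability at most
beta * J x y.  Hence the expected energy, on the random graph, of a
deterministic function is at most beta times its energy for the weights J, and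
everything reduces to the mean-field network with conductances J; percolation
enters through its one-edge marginals.

For J: the kernel decays at least like d^-4 and a ball of radius r has at most
C r^2 vertices, so the second moment of J truncated at distance r grows like
log r (kernel_truncated_second_moment).  A function decreasing logarithmically
in the distance to v would thus keep a bounded energy; with the slower slope
1/(r log r), whose integral is log log r, the cut-off at scale 2^n has energy
at most a constant divided by the n-th harmonic number (energy_loglog_cutoff).
This tends to 0, just barely, which is why the exponent 4 = 2d is the threshold.
The expected energies then tend to 0, so for almost every configuration the
infimum over n of the energies vanishes (ae_small_energy), for all of the
countably many centres v at once.

It remains to see that small energies prevent the walk from escaping
(no_escape_of_small_energy).  Let a be the probability of hitting v.  The
function u = 1 + a is positive and superharmonic off v, and Picone's inequality
(f x - f y)^2 >= (u x - u y) (f x^2 / u x - f y^2 / u y), summed over the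
edges, bounds the escape probability from v, times the degree of v, by the
energy of any finitely supported f with f v = 1.  The probability that an
arbitrary simple random walk returns to v is bounded from below in terms of a
by conditioning on finite histories (hit_lower_bound). *)

(** * Dirichlet energy and superharmonic functions *)

Section EnergyOfWeights.
Context {R : realType} {V : choiceType}.
Implicit Types (c : V -> V -> R) (f u : V -> R) (A : {fset V}).

(** The sum runs over ordered pairs, so each edge counts twice; restricting it
to a finite set keeps it a finite sum, and bounds are stated uniformly in A. *)
Definition energy c f A : R :=
  \sum_(x <- A) \sum_(y <- A) c x y * (f x - f y) ^+ 2.

(** Picone's inequality: the difference of the two sides of
(f x - f y)^2 >= (u x - u y) (f x^2 / u x - f y^2 / u y) is the square
(f x u y - f y u x)^2 / (u x u y).  Summed against the symmetric weights c, the
right-hand side becomes a sum of the Laplacian of u against f^2 / u. *)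
Lemma energy_ge_superharmonic c f u A :
  (forall x y, 0 <= c x y) -> (forall x y, c x y = c y x) ->
  (forall x, 0 < u x) ->
  2 * (\sum_(x <- A) f x ^+ 2 / u x * \sum_(y <- A) c x y * (u x - u y))
    <= energy c f A.
Proof.
move=> c_ge0 c_sym u_gt0.
pose g x := f x ^+ 2 / u x.
have -> : 2 * (\sum_(x <- A) f x ^+ 2 / u x * \sum_(y <- A) c x y * (u x - u y))
  = \sum_(x <- A) \sum_(y <- A) c x y * ((u x - u y) * (g x - g y)).
  rewrite mulr_natl mulr2n.
  under eq_bigr do rewrite mulr_sumr.
  rewrite {2}exchange_big -big_split/=; apply: eq_bigr => x _.
  rewrite -big_split/=; apply: eq_bigr => y _.
  by rewrite (c_sym y x) -/(g x) -/(g y); ring.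
apply: ler_sum => x _; apply: ler_sum => y _; apply: ler_wpM2l => //.
have [ux uy] := (u_gt0 x, u_gt0 y).
rewrite -subr_ge0.
suff -> : (f x - f y) ^+ 2 - (u x - u y) * (g x - g y)
        = (f x * u y - f y * u x) ^+ 2 / (u x * u y).
  by rewrite divr_ge0 ?sqr_ge0// mulr_ge0// ltW.
by rewrite /g; field; rewrite !gt_eqF.
Qed.

End EnergyOfWeights.

(** * Finite-horizon hitting probabilities *)

Section HittingProbabilities.
Context {R : realType} {V : choiceType}.
Variables (e : rel V) (v : V).
Implicit Types (n m : nat) (x y : V).

Local Notation N x := (fset_set (neighbours e x)).
Local Notation p := (@srw_step R V e).

Lemma srw_step_ge0 x y : 0 <= p x y.
Proof. by rewrite /srw_step; case: ifP => // _; rewrite invr_ge0. Qed.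

Lemma sum_srw_step_le1 x : \sum_(y <- N x) p x y <= 1.
Proof.
have [->|N0] := eqVneq (N x) fset0; first by rewrite big_seq_fset0.
apply: (@le_trans _ _ (\sum_(y <- N x) (#|` N x|)%:R^-1)).
  by apply: ler_sum => y _; rewrite /srw_step; case: ifP; rewrite ?invr_ge0.
rewrite big_const_seq count_predT iter_addr addr0 -[_ *+ _]mulr_natl.
by rewrite divff// pnatr_eq0 cardfs_eq0.
Qed.

(** The probability that a walk started at x is at v at some time at most n,
obtained by conditioning on the first step.  It refers to the transition matrix
alone, so that it can be compared with every process realising the walk. *)
Fixpoint hit n x : R :=
  if x == v then 1
  else if n is m.+1 then \sum_(y <- N x) p x y * hit m y else 0.

Lemma hit_target n : hit n v = 1.
Proof. by case: n => [|n]; rewrite /= eqxx. Qed.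

Lemma hitS n x : x != v -> hit n.+1 x = \sum_(y <- N x) p x y * hit n y.
Proof. by move=> /negPf /= ->. Qed.

Lemma hit_ge0 n x : 0 <= hit n x.
Proof.
elim: n x => [|n IH] x /=; case: ifP => // _.
by apply: sumr_ge0 => y _; rewrite mulr_ge0// srw_step_ge0.
Qed.

Lemma hit_le1 n x : hit n x <= 1.
Proof.
elim: n x => [|n IH] x /=; case: ifP => // _.
apply: le_trans (sum_srw_step_le1 x); apply: ler_sum => y _.
by rewrite ler_piMr// srw_step_ge0.
Qed.

(** Monotonicity in the horizon is what makes the limit, the probability of ever
hitting v, exist. *)
Lemma hit_leS n x : hit n x <= hit n.+1 x.
Proof.
elim: n x => [|n IH] x.
  by rewrite {1}/hit; case: ifP => [/eqP->|_]; rewrite ?hit_target ?hit_ge0.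
have [->|xv] := eqVneq x v; first by rewrite !hit_target.
rewrite !hitS//; apply: ler_sum => y _.
by apply: ler_wpM2l => //; exact: srw_step_ge0.
Qed.

Lemma cvg_hit x : hit n x @[n --> \oo] --> limn (hit ^~ x).
Proof.
have : cvgn (hit ^~ x).
  apply: nondecreasing_is_cvgn.
    by apply/nondecreasing_seqP => n; exact: hit_leS.
  by exists 1 => _ [n _ <-]; exact: hit_le1.
by [].
Qed.

Lemma cvg_step_hit x :
  \sum_(y <- N x) p x y * hit n y @[n --> \oo] -->
  \sum_(y <- N x) p x y * limn (hit ^~ y).
Proof.
apply: cvg_big => [|y _]; first exact: add_continuous.
by move=> Py; apply: cvgMl_tmp; exact: cvg_hit.
Qed.

End HittingProbabilities.

(** * Hitting probabilities bound the visits of a simple random walk *)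

Section WalkHits.
Context {R : realType} {V : choiceType}.
Variables (e : rel V) (v : V) (d : measure_display) (T : measurableType d).
Variables (Q : probability T R) (X : nat -> T -> V).
Hypothesis walkX : simple_random_walk e v Q X.
Implicit Types (n m : nat) (x : nat -> V).

Local Notation N x := (fset_set (neighbours e x)).
Local Notation p := (@srw_step R V e).

Definition history n x : set T := [set t | forall i, (i <= n)%N -> X i t = x i].

Definition visit_after n : set T := [set t | exists2 k, (n <= k)%N & X k t = v].

Definition extend n x (y : V) : nat -> V := fun i => if i == n.+1 then y else x i.

Let measurable_X k y : measurable [set t | X k t = y].
Proof. by case: walkX. Qed.

Lemma measurable_history n x : measurable (history n x).
Proof.
have -> : history n x =
    \bigcap_(i in [set i | (i <= n)%N]) [set t | X i t = x i] by [].
by apply: bigcap_measurable => //; exists 0%N.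
Qed.

Lemma measurable_visit_after n : measurable (visit_after n).
Proof.
have -> : visit_after n =
    \bigcup_(k in [set k | (n <= k)%N]) [set t | X k t = v].
  by apply/seteqP; split=> t [k]; exists k.
exact: bigcup_measurable.
Qed.

Lemma history_extend n x y :
  history n.+1 (extend n x y) = history n x `&` [set t | X n.+1 t = y].
Proof.
apply/seteqP; split=> t.
  move=> H; split; last by have := H _ (leqnn _); rewrite /extend eqxx.
  move=> i i_n; have := H i (leqW i_n).
  by rewrite /extend ltn_eqF.
move=> [H /= Xy] i; rewrite /extend leq_eqVlt; case: eqVneq => [->//|_ /= i_n].
exact: H.
Qed.

Lemma history_extendM n x y :
  Q (history n.+1 (extend n x y)) = (Q (history n x) * (p (x n) y)%:E)%E.
Proof.
have [_ _ step] := walkX; rewrite /history step /extend eqxx ltn_eqF//.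
congr (Q _ * _)%E; apply/seteqP; split=> t H i i_n; have := H i i_n.
  by rewrite ltn_eqF.
by rewrite ltn_eqF.
Qed.

(** The Markov property, in the only form used here: the one-step extensions of
a history towards the neighbours of its end point are disjoint, so a lower bound
for each of them adds up to one for the history itself.  When the end point has
infinite degree both its step probabilities and the enumeration of its
neighbours are trivial, and the bound still holds. *)
Lemma one_step_lower_bound n x (g : V -> R) (E : set T) :
  measurable E ->
  (forall y, Q (history n.+1 (extend n x y)) * (g y)%:E <=
             Q (history n.+1 (extend n x y) `&` E))%E ->
  (Q (history n x) * (\sum_(y <- N (x n)) p (x n) y * g y)%:E <=
   Q (history n x `&` E))%E.
Proof.
move=> mE gE.
pose F y := history n.+1 (extend n x y) `&` E.
have mF y : measurable (F y) by apply: measurableI => //; exact: measurable_history.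
have Qfin A : measurable A -> Q A \is a fin_num by move=> mA; exact: fin_num_measure.
apply: (@le_trans _ _ (\sum_(y <- N (x n)) Q (F y))%E).
  rewrite -(fineK (Qfin _ (measurable_history n x))) -EFinM mulr_sumr -sumEFin.
  apply: lee_sum => y _; apply: le_trans (gE y).
  rewrite history_extendM -(fineK (Qfin _ (measurable_history n x))) -!EFinM.
  by rewrite mulrA.
rewrite -measure_fbigsetU//; last first.
  apply/trivIsetP => y z _ _ yz; apply/seteqP; split=> // t.
  rewrite /F !history_extend => -[[[_ /= Xy] _] [[_ /= Xz] _]].
  by move/eqP: yz; apply; rewrite -Xy -Xz.
apply: le_measure; rewrite ?inE.
- exact: bigsetU_measurable.
- by apply: measurableI => //; exact: measurable_history.
rewrite -bigcup_fset => t [y _ []].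
by rewrite history_extend => -[].
Qed.

(** Induction on the horizon m.  The event on the right imposes no upper limit on
the time of the visit, so that it decreases in n and is compatible with the
extension of the history by one step. *)
Lemma hit_lower_bound m n x :
  (Q (history n x) * (hit e v m (x n))%:E <=
   Q (history n x `&` visit_after n))%E.
Proof.
have at_target k i z : z i = v ->
    (Q (history i z) * (hit e v k (z i))%:E <=
     Q (history i z `&` visit_after i))%E.
  move=> zv; rewrite zv hit_target mule1; apply: le_measure; rewrite ?inE.
  - exact: measurable_history.
  - by apply: measurableI; [exact: measurable_history | exact: measurable_visit_after].
  by move=> t H; split=> //; exists i => //; rewrite H.
elim: m n x => [|m IH] n x.
  have [|xv] := eqVneq (x n) v; first exact: at_target.
  by rewrite /= (negPf xv) mule0.
have [|xv] := eqVneq (x n) v; first exact: at_target.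
rewrite hitS//; apply: one_step_lower_bound; first exact: measurable_visit_after.
move=> y; have := IH n.+1 (extend n x y); rewrite {2}/extend eqxx => /le_trans; apply.
apply: le_measure; rewrite ?inE.
- by apply: measurableI; [exact: measurable_history | exact: measurable_visit_after].
- by apply: measurableI; [exact: measurable_history | exact: measurable_visit_after].
by apply: setIS => t [k nk Xk]; exists k => //; exact: ltnW.
Qed.

Lemma return_lower_bound m :
  ((\sum_(y <- N v) p v y * hit e v m y)%:E <= Q (visit_after 1))%E.
Proof.
pose x0 := fun _ : nat => v.
have := @one_step_lower_bound 0 x0 (hit e v m) (visit_after 1)
  (measurable_visit_after 1).
have -> : Q (history 0 x0) = 1%E.
  have [_ <- _] := walkX; congr (Q _); apply/seteqP; split=> t; first exact.
  by move=> Xv [].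
rewrite mul1e => /(_ _)/le_trans; apply.
  move=> y; have := hit_lower_bound m 1 (extend 0 x0 y).
  by rewrite {2}/extend eqxx.
apply: le_measure; rewrite ?inE; last exact: subIsetr.
- by apply: measurableI; [exact: measurable_history | exact: measurable_visit_after].
- exact: measurable_visit_after.
Qed.

End WalkHits.

(** * Small energies force the walk to return *)

Section RecurrenceCriterion.
Context {R : realType} {V : choiceType}.
Variable e : rel V.

Local Notation N x := (fset_set (neighbours e x)).
Local Notation p := (@srw_step R V e).
Local Notation unit_weight := (fun x y => (e x y)%:R : R).

(** Only finitely many neighbours of x lie in the support S; each of the others
contributes f x ^+ 2 to the energy. *)
Lemma finite_degree_of_energy (f : V -> R) (S : {fset V}) (delta : R) x :
  (forall y, y \notin S -> f y = 0) ->
  (forall A, energy unit_weight f A <= delta) ->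
  f x != 0 -> finite_set (neighbours e x).
Proof.
move=> f0 E_le fx0; apply: contrapT => Ninf.
have fx2 : 0 < f x ^+ 2 by rewrite exprn_even_gt0.
pose n := (Num.truncn (delta / f x ^+ 2)).+1.
have n_gt : delta < n%:R * f x ^+ 2 by rewrite -ltr_pdivrMr// truncnS_gt.
have NSinf : infinite_set (neighbours e x `\` [set` S]).
  by apply: infinite_setD.
have [B BN n_B] := infinite_set_fset n NSinf.
have xB : x \notin B.
  by apply/negP => /BN[_ /= /negP xS]; move/negP: fx0; apply; rewrite f0.
have := E_le (x |` B)%fset; apply/negP; rewrite -ltNge; apply: (lt_le_trans n_gt).
have term_ge0 y z : 0 <= (e y z)%:R * (f y - f z) ^+ 2 :> R.
  by rewrite mulr_ge0 ?sqr_ge0.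
rewrite /energy big_fsetU1//= -[leLHS]addr0 lerD//; last first.
  by apply: sumr_ge0 => y _; apply: sumr_ge0 => z _.
rewrite big_fsetU1//= -[leLHS]add0r lerD//.
rewrite (eq_big_seq (fun=> f x ^+ 2)); last first.
  by move=> y /BN[/= -> /negP yS]; rewrite mul1r (f0 y)// subr0.
rewrite big_const_seq count_predT iter_addr addr0 -[leRHS]mulr_natl.
by rewrite ler_pM2r// ler_nat.
Qed.

(** With u = 1 + a, where a is the probability of ever hitting v, the Laplacian
of u vanishes off v and equals deg(v) (1 - rho) at v, where rho is the
probability of returning to v.  Adding 1 to a makes u positive and leaves the
Laplacian unchanged. *)
Lemma no_escape_of_small_energy v :
  symmetric e -> (exists y, e v y) ->
  (forall delta : R, 0 < delta -> exists (f : V -> R) (S : {fset V}),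
    [/\ f v = 1, forall y, y \notin S -> f y = 0 &
        forall A, energy unit_weight f A <= delta]) ->
  ~ transient_from R e v.
Proof.
move=> e_sym [y0 vy0] small [d [T [Q [X [walkX Qret]]]]].
pose a x : R := limn (hit (R := R) e v ^~ x).
pose rho := \sum_(y <- N v) p v y * a y.
pose q := fine (Q (visit_after v X 1)).
have Qfin : Q (visit_after v X 1) \is a fin_num.
  by apply: fin_num_measure; exact: (measurable_visit_after walkX).
have q_lt1 : q < 1 by rewrite -lte_fin fineK.
have rho_q : rho <= q.
  have cv := @cvg_step_hit R V e v v.
  have <- : limn (fun n => \sum_(y <- N v) p v y * hit e v n y) = rho.
    exact: cvg_lim cv.
  apply: limr_le; first by apply/cvg_ex; exists rho.
  apply: nearW => n; rewrite -lee_fin fineK//.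
  exact: (return_lower_bound walkX).
have a_ge0 x : 0 <= a x.
  apply: limr_ge; first by apply/cvg_ex; exists (a x); exact: cvg_hit.
  by apply: nearW => n; exact: hit_ge0.
have av : a v = 1.
  rewrite /a; under eq_fun do rewrite hit_target.
  exact: lim_cst.
(* The recursion for hit passes to the limit in the horizon. *)
have a_harmonic x : x != v -> a x = \sum_(y <- N x) p x y * a y.
  move=> xv; have cv := @cvg_step_hit R V e v x.
  have cv' : hit e v n.+1 x @[n --> \oo] --> a x.
    by rewrite (cvg_shiftS (hit e v ^~ x)); exact: cvg_hit.
  rewrite -(cvg_lim _ cv')//; under eq_fun do rewrite hitS//.
  exact: cvg_lim cv.
have [f [S [fv f0 E_le]]] := small ((1 - q) / 2) ltac:(lra).
have finN x : f x != 0 -> finite_set (neighbours e x).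
  exact: finite_degree_of_energy f0 E_le.
have mN x y : f x != 0 -> (y \in N x) = e x y.
  by move=> /finN fN; rewrite in_fset_set//; apply/idP/idP; rewrite inE.
(* A contains the support of f with all its neighbours, so that the inner sums
   over A are full Laplacians wherever f does not vanish. *)
pose A := (S `|` \bigcup_(x <- S) N x)%fset.
pose u x := 1 + a x.
have inner x : f x != 0 ->
    \sum_(y <- A) (e x y)%:R * (u x - u y) =
    (#|` N x|)%:R * (a x - \sum_(y <- N x) p x y * a y).
  move=> fx0; have xS : x \in S by apply: contraNT fx0 => /f0->.
  have NA : (N x `<=` A)%fset.
    apply/fsubsetP => y yN; rewrite inE; apply/orP; right.
    by apply/bigfcupP; exists x; rewrite ?xS.
  rewrite -(big_fset_incl _ NA); last first.
    move=> y _ yN; have /negPf-> : ~~ e x y; last by rewrite mul0r.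
    by apply: contra yN; rewrite mN.
  rewrite mulrBr mulr_sumr.
  have -> : (#|` N x|)%:R * a x = \sum_(y <- N x) a x.
    by rewrite big_const_seq count_predT iter_addr addr0 -[RHS]mulr_natl.
  rewrite -sumrB; apply: eq_big_seq => y yN.
  move: (yN); rewrite mN// /srw_step => ->; rewrite mul1r mulrA divff ?mul1r; first by rewrite /u; ring.
  by rewrite pnatr_eq0 cardfs_eq0; apply: contraTneq yN => ->; rewrite inE.
have vA : v \in A.
  by rewrite inE; apply/orP; left; apply: contraT => /f0; rewrite fv => /eqP; rewrite oner_eq0.
have := @energy_ge_superharmonic R V unit_weight f u A (fun x y => ler0n _ _)
  (fun x y => congr1 (fun b : bool => b%:R) (e_sym x y))
  (fun x => ltr_pwDl ltr01 (a_ge0 x)).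
move=> /le_trans/(_ (E_le A)); apply/negP; rewrite -ltNge.
have deg_ge1 : 1 <= (#|` N v|)%:R :> R.
  rewrite ler1n cardfs_gt0; apply/fset0Pn; exists y0.
  by rewrite mN// fv oner_neq0.
have v_term : (1 - rho) / 2 <=
    f v ^+ 2 / u v * \sum_(y <- A) (e v y)%:R * (u v - u y).
  rewrite inner ?fv ?oner_neq0// /u av -/rho expr1n.
  have : 1 - rho <= (#|` N v|)%:R * (1 - rho) by rewrite ler_peMl//; lra.
  by have -> : 1 + 1 = 2 :> R by []; lra.
have rest_ge0 : 0 <= \sum_(x <- (A `\ v)%fset)
    f x ^+ 2 / u x * \sum_(y <- A) (e x y)%:R * (u x - u y).
  rewrite big_seq; apply: sumr_ge0 => x; rewrite !inE => /andP[xv _].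
  have [->|fx0] := eqVneq (f x) 0; first by rewrite expr0n !mul0r.
  by rewrite inner// -a_harmonic// subrr !mulr0.
rewrite (big_fsetD1 v)//=.
lra.
Qed.

End RecurrenceCriterion.

(** * The slope 1/(s log s) and its partial sums *)

Section LogLogWeights.
Context {R : realType}.
Implicit Types (r s d n N : nat).

Local Notation ell := (trunc_log 2).

Lemma ell_lt r : (r.+1 <= 2 ^ (ell r).+1)%N.
Proof. exact: trunc_log_ltn. Qed.

Lemma ell_ge r : (2 ^ ell r <= r.+1)%N.
Proof. by case: r => [//|r]; apply: leqW; exact: trunc_logP. Qed.

(** The slope 1/(s log s), with the logarithm replaced by the index of the dyadic
scale of s; the shifts by one keep it finite at s = 0 and s = 1. *)
Definition weight s : R := (s.+1%:R * (ell s).+1%:R)^-1.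

Definition weight_tail N r : R := \sum_(r <= s < N) weight s.

Lemma weight_gt0 s : 0 < weight s.
Proof. by rewrite invr_gt0 mulr_gt0. Qed.

(** The logarithmic factor can only help, as trunc_log is monotone. *)
Lemma weight_decay r d :
  weight (r + d) <= weight r * (r.+1%:R / (r.+1%:R + d%:R)).
Proof.
have -> : weight r * (r.+1%:R / (r.+1%:R + d%:R)) =
    ((r + d).+1%:R * (ell r).+1%:R)^-1.
  rewrite /weight -addSn natrD; field.
  by rewrite !nat1r -natrD !pnatr_eq0.
rewrite lef_pV2 ?posrE ?mulr_gt0// ler_pM2l// ler_nat ltnS.
by apply: leq_trunc_log; exact: leq_addr.
Qed.

(** Two bounds for the variation of the cut-off over a distance d starting from
radius r: the first, from monotonicity, is sharp for d <= r; the second, of the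
order of sqrt(d r), is crude, but makes the sum of its square against d^-4
converge over long edges in dimension 2. *)
Lemma weight_sum_bounds r d :
  \sum_(r <= s < r + d) weight s <= d%:R * weight r /\
  (\sum_(r <= s < r + d) weight s) ^+ 2 <= 2 * d%:R * r.+1%:R * weight r ^+ 2.
Proof.
elim: d => [|d [IH1 IH2]].
  by rewrite addn0 big_geq// expr0n !mulr0 !mul0r.
rewrite addnS big_nat_recr ?leq_addr//=.
have := weight_decay r d.
have := weight_gt0 (r + d); have := weight_gt0 r.
have : 0 <= \sum_(r <= s < r + d) weight s.
  by apply: sumr_ge0 => s _; exact/ltW/weight_gt0.
move: IH1 IH2.
set S := \sum_(r <= s < r + d) weight s.
move: (weight r) (weight (r + d)) => w w' IH1 IH2 S_ge0 w_gt0 w'_gt0 w'_le.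
have a_ge1 : 1 <= r.+1%:R :> R by rewrite ler1n.
rewrite -[d.+1]addn1 natrD.
have d_ge0 : 0 <= d%:R :> R by [].
move: (r.+1%:R) (d%:R) IH1 IH2 w'_le a_ge1 d_ge0 => a D IH1 IH2 w'_le a_ge1 D_ge0.
(* a stands for r.+1, D for d and w' for the next weight; by weight_decay,
   w' <= w z. *)
pose z := a / (a + D).
have aD : 0 < a + D by lra.
have z_gt0 : 0 < z by rewrite divr_gt0//; lra.
have z_le1 : z <= 1 by rewrite ler_pdivrMr//; lra.
have Dz : D * z = a * (1 - z) by rewrite /z; field; rewrite gt_eqF.
have w'_wz : w' <= w * z by [].
split; first by nra.
have cross : S * w' <= w ^+ 2 * (a * (1 - z)).
  apply: (@le_trans _ _ ((D * w) * (w * z))).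
    by apply: ler_pM => //; exact: ltW.
  by rewrite -Dz le_eqVlt; apply/orP; left; apply/eqP; ring.
have square : w' ^+ 2 <= w ^+ 2 * (a * z).
  apply: (@le_trans _ _ ((w * z) ^+ 2)).
    by apply: lerXn2r => //; rewrite nnegrE; [|apply: mulr_ge0]; exact: ltW.
  have z_a : z <= a by exact: le_trans a_ge1.
  by rewrite exprMn ler_pM2l ?exprn_gt0// expr2 ler_pM2r.
have waz : 0 <= w ^+ 2 * (a * z) by rewrite mulr_ge0 ?sqr_ge0// mulr_ge0 ?(ltW z_gt0)//; lra.
nra.
Qed.

Lemma weight_tail_ge0 N r : 0 <= weight_tail N r.
Proof. by apply: sumr_ge0 => s _; exact/ltW/weight_gt0. Qed.

Lemma weight_tail_le N r r' : (r <= r')%N -> weight_tail N r' <= weight_tail N r.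
Proof.
move=> r_r'; have [r'_N|/ltnW N_r'] := leqP r' N.
  rewrite /weight_tail (big_cat_nat r_r' r'_N)/= lerDr.
  by apply: sumr_ge0 => s _; exact/ltW/weight_gt0.
by rewrite [X in X <= _]/weight_tail big_geq// weight_tail_ge0.
Qed.

Lemma weight_tail_increment N r r' d : (r <= r' <= r + d)%N ->
  (weight_tail N r - weight_tail N r') ^+ 2 <=
  if (r < N)%N then
    weight r ^+ 2 * Num.min (d%:R ^+ 2) (2 * d%:R * r.+1%:R)
  else 0.
Proof.
move=> /andP[r_r' r'_d]; case: ifPn; last first.
  rewrite -leqNgt => N_r.
  by rewrite /weight_tail !big_geq ?(leq_trans N_r)// subr0 expr0n.
move=> r_N.
have incr_ge0 : 0 <= weight_tail N r - weight_tail N r'.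
  by rewrite subr_ge0 weight_tail_le.
have incr_le : weight_tail N r - weight_tail N r' <=
    \sum_(r <= s < r + d) weight s.
  rewrite lerBlDr; have [rd_N|/ltnW N_rd] := leqP (r + d) N.
    rewrite {1}/weight_tail (big_cat_nat (leq_addr d r) rd_N)/= lerD2l.
    exact: weight_tail_le.
  rewrite (big_cat_nat (ltnW r_N) N_rd)/= -[leLHS]addr0 -addrA lerD2l.
  by rewrite addr_ge0 ?weight_tail_ge0.
have [S1 S2] := weight_sum_bounds r d.
have S_ge0 := le_trans incr_ge0 incr_le.
apply: (@le_trans _ _ ((\sum_(r <= s < r + d) weight s) ^+ 2)).
  by rewrite lerXn2r// nnegrE.
rewrite minr_pMr ?sqr_ge0// le_min; apply/andP; split.
  by rewrite -exprMn mulrC lerXn2r ?nnegrE// mulr_ge0//; exact/ltW/weight_gt0.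
by rewrite mulrC.
Qed.

Lemma series_harmonic_gt0 n : 0 < series (@harmonic R) n.+1.
Proof.
rewrite /series/= big_nat_recr//= ltr_wpDl ?harmonic_gt0//.
by apply: sumr_ge0 => k _; exact: harmonic_ge0.
Qed.

(** Each dyadic block of 2 ^ k integers with k < n carries a total weight of at
least 1/(2 (k + 1)). *)
Lemma weight_tail_log_growth n :
  series harmonic n / 2 <= weight_tail (2 ^ n) 0.
Proof.
elim: n => [|n IH]; first by rewrite /series/= big_geq// mul0r weight_tail_ge0.
have n_nS : (2 ^ n <= 2 ^ n.+1)%N by rewrite leq_exp2l.
rewrite /weight_tail (big_cat_nat (leq0n _) n_nS)/= -/(weight_tail _ 0).
rewrite /series/= big_nat_recr//= mulrDl lerD//.
apply: (@le_trans _ _ (\sum_(2 ^ n <= s < 2 ^ n.+1) ((2 ^ n.+1)%:R * n.+1%:R)^-1)).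
  rewrite big_const_nat iter_addr addr0 expnS mul2n -addnn addnK -[leRHS]mulr_natl.
  rewrite natrD /harmonic/=; rewrite le_eqVlt; apply/orP; left; apply/eqP.
  by field; rewrite nat1r -natrD !pnatr_eq0 addn_eq0 expn_eq0.
apply: ler_sum_nat => s /andP[ns sn].
rewrite lef_pV2 ?posrE ?mulr_gt0 ?ltr0n ?expn_gt0//.
by rewrite (@trunc_log_eq 2 n)// ?ns// ler_pM2r// ler_nat.
Qed.

(** The first m terms are at most 1, and the others form a geometric series. *)
Lemma sum_min1_geometric m M :
  \sum_(j < M) Num.min 1 (2 ^+ m / 2 ^+ j) <= (m + 2)%:R :> R.
Proof.
elim: m M => [|m IH] M.
  apply: (@le_trans _ _ (2 - 2 / 2 ^+ M)); last first.
    by rewrite add0n gerBl divr_ge0// exprn_ge0.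
  elim: M => [|M IH]; first by rewrite big_ord0 expr0; lra.
  rewrite big_ord_recr/= exprS expr0 div1r invfM mulrA divff// mul1r.
  have : Num.min 1 ((2 : R) ^- M) <= 2 ^- M by rewrite ge_min lexx orbT.
  lra.
case: M => [|M]; first by rewrite big_ord0.
rewrite big_ord_recl/= addSn -[leRHS]natr1 [leRHS]addrC; apply: lerD; first by rewrite ge_min lexx.
apply: le_trans (IH M); apply: ler_sum => j _.
by rewrite /bump/= add1n !exprS invfM mulrACA divff// mul1r.
Qed.

End LogLogWeights.

(** * Energy of the cut-offs for a kernel decaying like d^-4 *)

Section KernelEnergy.
Context {R : realType} {V : choiceType}.
Variables (dist : V -> V -> nat) (J : V -> V -> R) (C K : R).
Hypothesis dist_triangle : forall x y z, (dist x z <= dist x y + dist y z)%N.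
Hypothesis C_ge0 : 0 <= C.
Hypothesis volume : forall x r (A : {fset V}), (0 < r)%N ->
  (forall y, y \in A -> (dist x y <= r)%N) -> (#|` A|)%:R <= C * r%:R ^+ 2.
Hypothesis J_ge0 : forall x y, 0 <= J x y.
Hypothesis J_sym : forall x y, J x y = J y x.
Hypothesis J_decay : forall x y, J x y * (dist x y)%:R ^+ 4 <= K.
Implicit Types (x y o : V) (A : {fset V}) (n r : nat).

Local Notation ell := (trunc_log 2).

Lemma decay_constant_ge0 (x : V) : 0 <= K.
Proof. by apply: le_trans (J_decay x x); rewrite mulr_ge0 ?exprn_ge0. Qed.

(** Grouping the vertices by dyadic distance; the j-th shell lies in the ball of
radius 2 ^ j.+1, which has at most 4 C 4 ^ j vertices. *)
Lemma dyadic_shell_sum x A M (b : nat -> R) :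
  (forall j, 0 <= b j) -> (forall y, y \in A -> (ell (dist x y) < M)%N) ->
  \sum_(y <- A) b (ell (dist x y)) <= 4 * C * \sum_(j < M) 4 ^+ j * b j.
Proof.
move=> b_ge0 A_M.
have -> : \sum_(y <- A) b (ell (dist x y)) =
    \sum_(y <- A) \sum_(j < M) (ell (dist x y) == j)%:R * b j.
  rewrite !big_seq; apply: eq_bigr => y /A_M yM.
  rewrite (bigD1 (Ordinal yM))//= eqxx mul1r big1 ?addr0// => j jy.
  by rewrite (_ : _ == _ = false) ?mul0r//; apply: contraNF jy => /eqP yj; apply/eqP/val_inj.
rewrite exchange_big mulr_sumr; apply: ler_sum => j _.
rewrite -mulr_suml mulrA ler_wpM2r//.
pose Aj := [fset y in A | ell (dist x y) == j]%fset.
have -> : \sum_(y <- A) (ell (dist x y) == j)%:R = (#|` Aj|)%:R :> R.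
  rewrite -(big_fset_incl _ (fset_sub A (fun y => ell (dist x y) == j))); last first.
    by move=> y yA; rewrite !inE yA/= => /negPf ->.
  rewrite (eq_big_seq (fun=> 1)); last by move=> y; rewrite !inE => /andP[_ ->].
  by rewrite big_const_seq count_predT iter_addr addr0.
apply: le_trans (volume (x := x) (r := 2 ^ j.+1) _ _) _.
- by rewrite expn_gt0.
- by move=> y; rewrite !inE => /andP[_ /eqP <-]; exact/ltnW/trunc_log_ltn.
have sqr2 : 2 ^+ 2 = 4 :> R by rewrite -natrX.
rewrite natrX -exprM mulnC exprM sqr2 exprS.
by rewrite le_eqVlt; apply/orP; left; apply/eqP; ring.
Qed.

(** A shell at scale 2 ^ j contributes a constant to the second moment as long as
2 ^ j <= r, whence the logarithm.  At larger scales, where d^2 is replaced by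
d r, the contribution r / 2 ^ j is summable: the long edges add only a
constant. *)
Lemma kernel_truncated_second_moment x A r :
  \sum_(y <- A) J x y *
    Num.min ((dist x y)%:R ^+ 2) (2 * (dist x y)%:R * r.+1%:R)
  <= 16 * K * C * (ell r).+1%:R.
Proof.
pose b j : R := K * Num.min (4 ^+ j)^-1 (2 * r.+1%:R / 8 ^+ j).
have b_ge0 j : 0 <= b j.
  by rewrite mulr_ge0 ?(decay_constant_ge0 x)// le_min invr_ge0 exprn_ge0// divr_ge0// exprn_ge0.
pose M := (\max_(y <- A) ell (dist x y)).+1.
have A_M y : y \in A -> (ell (dist x y) < M)%N.
  by move=> yA; rewrite ltnS; apply: leq_bigmax_seq.
apply: (@le_trans _ _ (\sum_(y <- A) b (ell (dist x y)))).
  apply: ler_sum => y _.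
  have [d0|d_gt0] := posnP (dist x y).
    rewrite d0 expr0n !mulr0 mul0r minxx mulr0.
    exact: b_ge0.
  have dR : 0 < (dist x y)%:R :> R by rewrite ltr0n.
  have J_le : J x y <= K / (dist x y)%:R ^+ 4 by rewrite ler_pdivlMr ?exprn_gt0.
  have dyadic m : ((dist x y)%:R ^+ m)^-1 <= ((2 ^ m)%:R ^+ ell (dist x y))^-1 :> R.
    rewrite lef_pV2 ?posrE ?exprn_gt0 ?ltr0n ?expn_gt0// natrX -exprM mulnC exprM.
    rewrite lerXn2r ?nnegrE ?exprn_ge0// -natrX ler_nat.
    exact: trunc_logP.
  rewrite /b [leRHS]minr_pMr ?(decay_constant_ge0 x)// [leLHS]minr_pMr// le_min !ge_min.
  apply/andP; split; apply/orP; [left|right].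
    apply: (@le_trans _ _ (K / (dist x y)%:R ^+ 4 * (dist x y)%:R ^+ 2)).
      by rewrite ler_wpM2r ?exprn_ge0.
    rewrite (_ : _ * _ ^+ 2 = K * ((dist x y)%:R ^+ 2)^-1); last first.
      by field; rewrite gt_eqF.
    by rewrite ler_wpM2l ?(decay_constant_ge0 x)//; exact: (dyadic 2%N).
  apply: (@le_trans _ _ (K / (dist x y)%:R ^+ 4 * (2 * (dist x y)%:R * r.+1%:R))).
    by rewrite ler_wpM2r// !mulr_ge0.
  rewrite (_ : _ * (2 * _ * _) = K * (2 * r.+1%:R * ((dist x y)%:R ^+ 3)^-1)); last first.
    by field; rewrite gt_eqF.
  by rewrite ler_wpM2l ?(decay_constant_ge0 x)// ler_wpM2l//; exact: (dyadic 3%N).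
apply: le_trans (dyadic_shell_sum b_ge0 A_M) _.
have -> : 16 * K * C * (ell r).+1%:R = 4 * C * (K * (4 * (ell r).+1%:R)) by ring.
rewrite ler_wpM2l ?mulr_ge0//.
apply: (@le_trans _ _ (K * \sum_(j < M) Num.min 1 (2 ^+ (ell r).+2 / 2 ^+ j))).
  rewrite mulr_sumr; apply: ler_sum => j _.
  rewrite /b mulrCA ler_wpM2l ?(decay_constant_ge0 x)// minr_pMr ?exprn_ge0// le_min.
  rewrite !ge_min divff ?expf_neq0// lexx/=; apply/orP; right.
  rewrite (_ : 8 = 4 * 2 :> R); last by ring.
  rewrite exprMn invfM mulrCA [X in _ * X]mulrA divff ?expf_neq0// mul1r.
  rewrite ler_wpM2r ?invr_ge0 ?exprn_ge0// exprS ler_wpM2l// -natrX ler_nat.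
  exact: ell_lt.
rewrite ler_wpM2l ?(decay_constant_ge0 x)//; apply: le_trans (sum_min1_geometric _ _) _.
by rewrite -natrM ler_nat; lia.
Qed.

(** An edge is charged to its end point of lower height, where the slope of the
cut-off is larger. *)
Lemma energy_le_ordered (c : V -> V -> R) (f : V -> R) (h : V -> nat) A :
  (forall x y, 0 <= c x y) -> (forall x y, c x y = c y x) ->
  energy c f A <=
  2 * \sum_(x <- A) \sum_(y <- A | (h x <= h y)%N) c x y * (f x - f y) ^+ 2.
Proof.
move=> c_ge0 c_sym; pose F x y := c x y * (f x - f y) ^+ 2.
have F_sym x y : F x y = F y x by rewrite /F c_sym -sqrrN opprB.
have F_ge0 x y : 0 <= F x y by rewrite mulr_ge0 ?sqr_ge0.
pose G x y := if (h x <= h y)%N then F x y else 0.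
have -> : 2 * \sum_(x <- A) \sum_(y <- A | (h x <= h y)%N) F x y =
    \sum_(x <- A) \sum_(y <- A) (G x y + G y x).
  under eq_bigr do rewrite big_mkcond/=.
  under [RHS]eq_bigr do rewrite big_split/=.
  by rewrite big_split/= [X in _ = _ + X]exchange_big/= mulr_natl mulr2n.
apply: ler_sum => x _; apply: ler_sum => y _; rewrite -/(F x y) /G.
have [_|hyx] := leqP (h x) (h y); first by rewrite lerDl; case: ifP.
by rewrite (ltnW hyx) add0r F_sym.
Qed.

Definition loglog_cutoff o n x : R :=
  weight_tail (2 ^ n) (dist o x) / weight_tail (2 ^ n) 0.

(** At scale 2 ^ j there are of the order of 4 ^ j vertices, each contributing
about 4 ^- j / (j + 1). *)
Lemma sum_loglog_weights o A n : (0 < n)%N ->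
  \sum_(x <- A | (dist o x < 2 ^ n)%N)
     weight (dist o x) ^+ 2 * (ell (dist o x)).+1%:R
  <= 4 * C * series harmonic n.
Proof.
move=> n_gt0; pose b j : R := (4 ^+ j * j.+1%:R)^-1.
have b_ge0 j : 0 <= b j by rewrite invr_ge0 mulr_ge0// exprn_ge0.
pose A' := [fset x in A | (dist o x < 2 ^ n)%N]%fset.
have A'_n x : x \in A' -> (ell (dist o x) < n)%N.
  rewrite !inE => /andP[_ dx]; have [->|d_gt0] := posnP (dist o x).
    by rewrite trunc_log0.
  by rewrite -(@ltn_exp2l 2)//; apply: leq_ltn_trans dx; exact: trunc_logP.
rewrite big_fset_condE/= -/A'.
apply: (@le_trans _ _ (\sum_(x <- A') b (ell (dist o x)))).
  apply: ler_sum => x _.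
  set r := dist o x.
  have -> : weight r ^+ 2 * (ell r).+1%:R = (r.+1%:R ^+ 2 * (ell r).+1%:R)^-1 :> R.
    by rewrite /weight; field; rewrite !nat1r !pnatr_eq0.
  rewrite lef_pV2 ?posrE ?mulr_gt0 ?exprn_gt0// ler_pM2r//.
  rewrite (_ : 4 = 2 * 2 :> R); last by ring.
  rewrite exprMn expr2.
  by apply: ler_pM; rewrite ?exprn_ge0// -natrX ler_nat ell_ge.
apply: le_trans (dyadic_shell_sum b_ge0 A'_n) _.
rewrite ler_wpM2l ?mulr_ge0// /series/= big_mkord; apply: ler_sum => j _.
by rewrite /b invfM mulrA divff ?mul1r// expf_neq0.
Qed.

(** The unnormalised cut-off has energy of the order of the harmonic sum H: the
square of the slope at x, times the truncated second moment of J, is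
1/(r^2 log r), and these sum up to H.  Its height is also of the order of H, so
normalising by the square of the height leaves 1/H. *)
Lemma energy_loglog_cutoff o A n : (0 < n)%N ->
  energy J (loglog_cutoff o n) A <= 512 * K * C ^+ 2 / series harmonic n.
Proof.
move=> n_gt0; set H := series harmonic n.
have H_gt0 : 0 < H by rewrite /H; case: n n_gt0 {H} => // n _; exact: series_harmonic_gt0.
pose W : R := weight_tail (2 ^ n) 0.
have W_ge : H / 2 <= W by exact: weight_tail_log_growth.
have W_gt0 : 0 < W by apply: lt_le_trans W_ge; rewrite divr_gt0.
pose g x : R := weight_tail (2 ^ n) (dist o x).
have -> : energy J (loglog_cutoff o n) A = energy J g A / W ^+ 2.
  rewrite /energy mulr_suml; apply: eq_bigr => x _.
  rewrite mulr_suml; apply: eq_bigr => y _.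
  by rewrite /loglog_cutoff -/W -/(g x) -/(g y); field; rewrite gt_eqF.
have Eg : energy J g A <= 128 * K * C ^+ 2 * H.
  apply: le_trans (energy_le_ordered g (dist o) A J_ge0 J_sym) _.
  apply: (@le_trans _ _ (2 * \sum_(x <- A | (dist o x < 2 ^ n)%N)
      weight (dist o x) ^+ 2 * (16 * K * C * (ell (dist o x)).+1%:R))); last first.
    under eq_bigr do rewrite mulrCA.
    rewrite -mulr_sumr.
    apply: (@le_trans _ _ (2 * (16 * K * C * (4 * C * H)))).
      rewrite ler_wpM2l// ler_wpM2l ?mulr_ge0 ?(decay_constant_ge0 o)//.
      exact: sum_loglog_weights.
    by rewrite le_eqVlt; apply/orP; left; apply/eqP; ring.
  rewrite ler_wpM2l// [leRHS]big_mkcond; apply: ler_sum => x _.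
  apply: (@le_trans _ _ (\sum_(y <- A | (dist o x <= dist o y)%N) J x y *
      if (dist o x < 2 ^ n)%N then weight (dist o x) ^+ 2 *
        Num.min ((dist x y)%:R ^+ 2) (2 * (dist x y)%:R * (dist o x).+1%:R)
      else 0)).
    apply: ler_sum => y oxy; rewrite ler_wpM2l//.
    by apply: weight_tail_increment; rewrite oxy dist_triangle.
  case: ifP => _; last by rewrite big1// => y _; rewrite mulr0.
  under eq_bigr do rewrite mulrCA.
  rewrite -mulr_sumr ler_wpM2l ?sqr_ge0//.
  apply: le_trans (kernel_truncated_second_moment x A (dist o x)).
  rewrite [leLHS]big_mkcond; apply: ler_sum => y _; case: ifP => // _.
  by rewrite mulr_ge0// le_min exprn_ge0// !mulr_ge0.
apply: (@le_trans _ _ (128 * K * C ^+ 2 * H / (H / 2) ^+ 2)).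
  apply: ler_pM => //.
  - by apply: sumr_ge0 => x _; apply: sumr_ge0 => y _; rewrite mulr_ge0 ?sqr_ge0.
  - by rewrite invr_ge0 sqr_ge0.
  rewrite lef_pV2 ?posrE ?exprn_gt0 ?divr_gt0// lerXn2r// nnegrE ltW// divr_gt0//.
by rewrite le_eqVlt; apply/orP; left; apply/eqP; field; rewrite gt_eqF.
Qed.

End KernelEnergy.

(** * Distance, volume and kernel in a transitive graph *)

Section GraphDistance.
Context {V : choiceType}.
Variable e : rel V.
Implicit Types (x y z : V) (r : nat).

Lemma gdist_spec x y : joined e x y ->
  walk_lengths e x y (gdist e x y) /\
  forall m, walk_lengths e x y m -> (gdist e x y <= m)%N.
Proof.
move=> [n xy_n]; pose P k := `[< walk_lengths e x y k >].
have exP : exists k, P k by exists n; apply/asboolP.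
have [m /asboolP xy_m m_min] := ex_minnP exP.
apply: (xgetPex 0%N (P := [set k | walk_lengths e x y k /\
  forall m, walk_lengths e x y m -> (k <= m)%N])).
by exists m; split=> // k xy_k; apply: m_min; apply/asboolP.
Qed.

Lemma gdist_le x p : path e x p -> (gdist e x (last x p) <= size p)%N.
Proof.
move=> xp; have walk : walk_lengths e x (last x p) (size p) by exists p.
by have [_] := gdist_spec (ex_intro _ _ walk); exact.
Qed.

Lemma gdistxx x : gdist e x x = 0%N.
Proof. by apply/eqP; rewrite -leqn0; exact: (@gdist_le x [::]). Qed.

Hypothesis e_connected : connected_graph e.

Lemma gdist_walk x y :
  exists p, [/\ path e x p, last x p = y & size p = gdist e x y].
Proof.
by have [[p xp [lp sp]] _] := gdist_spec (e_connected x y); exists p.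
Qed.

Lemma gdist_triangle x y z : (gdist e x z <= gdist e x y + gdist e y z)%N.
Proof.
have [p [xp lp <-]] := gdist_walk x y; have [q [yq lq <-]] := gdist_walk y z.
rewrite -size_cat -lq -lp -last_cat; apply: gdist_le.
by rewrite cat_path xp lp.
Qed.

Lemma gdist_gt0 x y : x != y -> (0 < gdist e x y)%N.
Proof.
have [[|a p] [_ lp <-]//] := gdist_walk x y.
by move: lp => /= ->; rewrite eqxx.
Qed.

Lemma automorphism_gdist g x y : automorphism e g ->
  gdist e (g x) (g y) = gdist e x y.
Proof.
move=> [[h gh hg] e_g]; rewrite /gdist.
suff -> : walk_lengths e (g x) (g y) = walk_lengths e x y by [].
have e_h a b : e (h a) (h b) = e a b by rewrite -e_g !hg.
apply/seteqP; split=> _ [p xp [lp <-]].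
  exists (map h p); last by rewrite size_map -[x]gh last_map lp gh.
  by rewrite -[x]gh path_map; apply: sub_path xp => a b; rewrite /= e_h.
exists (map g p); last by rewrite size_map last_map lp.
by rewrite path_map; apply: sub_path xp => a b; rewrite /= e_g.
Qed.

End GraphDistance.

Section VolumeAndKernel.
Context {R : realType} {V : choiceType}.
Variables (e : rel V) (o : V).
Hypotheses (e_connected : connected_graph e) (e_transitive : transitive_graph e).

(** The enumeration of an infinite set is empty, which the lower bound on the
volume excludes at positive radii. *)
Lemma finite_gball d r : growth_dimension R e o d -> finite_set (gball e o r).
Proof.
move=> [c [C [c_gt0 _ growth]]].
suff fin_succ : finite_set (gball e o r.+1).
  by apply: sub_finite_set fin_succ => y; rewrite /gball/= => /leqW.
apply: contrapT => inf; have /andP[+ _] := growth r.+1 isT.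
rewrite /fset_set; case: pselect => // _.
by rewrite cardfs0 leNgt mulr_gt0// exprn_gt0.
Qed.

(** An automorphism taking o to x maps balls around o onto balls around x. *)
Lemma uniform_volume_bound d : growth_dimension R e o d ->
  exists2 C : R, 0 <= C & forall x r (A : {fset V}), (0 < r)%N ->
    (forall y, y \in A -> (gdist e x y <= r)%N) -> (#|` A|)%:R <= C * r%:R ^+ d.
Proof.
move=> growth_o; have [c [C [_ C_gt0 growth]]] := growth_o.
exists C; first exact: ltW.
move=> x r A r_gt0 A_r; have /andP[_] := growth r r_gt0.
apply: le_trans; rewrite ler_nat.
have [g g_aut gox] := e_transitive o x.
have fin_o := finite_gball r growth_o.
have card_image : (#|` (g @` fset_set (gball e o r))%fset| <=
    #|` fset_set (gball e o r)|)%N by exact: leq_imfset_card.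
apply: leq_trans card_image.
apply: fsubset_leq_card; apply/fsubsetP => y /A_r.
have [[h gh hg] _] := g_aut.
rewrite -gox -{1}[y]hg (automorphism_gdist _ _ g_aut) => hy.
apply/imfsetP; exists (h y) => //=.
by rewrite in_fset_set// inE.
Qed.

Variable J : V -> V -> R.
Hypotheses (J_ge0 : kernel_ge0 J) (J_transitive : kernel_transitive e J).

(** By transitivity each value off the diagonal is a term of the sum at o. *)
Lemma kernel_bounded : kernel_integrable o J ->
  exists2 S : R, 0 <= S & forall x y, x != y -> J x y <= S.
Proof.
rewrite /kernel_integrable; set E := esum _ _ => E_fin.
have E_ge0 : (0 <= E)%E by apply: esum_ge0 => x _; rewrite lee_fin.
have E_num : E \is a fin_num by rewrite ge0_fin_numE.
exists (fine E); first exact: fine_ge0.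
move=> x y xy; have [g g_aut gox] := e_transitive o x.
have [[h gh hg] _] := g_aut.
rewrite -gox -[y]hg (J_transitive g_aut) -lee_fin fineK//.
apply: esum_ge; exists [set h y]; last by rewrite fsbig_set1.
split; first exact: finite_set1.
by move=> _ -> /= hyo; move/eqP: xy; apply; rewrite -gox -hyo hg.
Qed.

(** The decay holds at large distances by hypothesis, and below the threshold r
because J is bounded off the diagonal.  Clearing the power of the distance
makes the bound true on the diagonal as well, where it reads 0 <= K. *)
Lemma kernel_polynomial_decay (s : R) (m : nat) : (0 < m)%N -> m%:R <= s ->
  kernel_integrable o J -> kernel_bigO e J s ->
  exists K : R, forall x y, J x y * (gdist e x y)%:R ^+ m <= K.
Proof.
move=> m_gt0 m_s /kernel_bounded[S S_ge0 J_S] [C [r [C_gt0 r_gt0 J_C]]].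
have Sr_ge0 : 0 <= S * r ^+ m by rewrite mulr_ge0// exprn_ge0// ltW.
exists (C + S * r ^+ m) => x y.
have [->|xy] := eqVneq x y.
  by rewrite gdistxx expr0n -leqn0 leqNgt m_gt0 mulr0 addr_ge0// ltW.
have d_gt0 := gdist_gt0 e_connected xy.
set d := (gdist e x y)%:R; have d_ge1 : 1 <= d :> R by rewrite ler1n.
have d0 : 0 < d :> R by exact: lt_le_trans d_ge1.
have [r_d|d_r] := leP r d; last first.
  apply: ler_wpDl; first exact: ltW.
  apply: ler_pM; rewrite ?exprn_ge0 ?J_S//.
  by rewrite lerXn2r ?nnegrE ?ltW.
apply: ler_wpDr => //.
rewrite -ler_pdivlMr ?exprn_gt0//; apply: le_trans (J_C _ _ r_d) _.
rewrite ler_wpM2l ?(ltW C_gt0)// powRN -powR_mulrn ?(ltW d0)//.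
by rewrite lef_pV2 ?posrE ?powR_gt0// ler_powR.
Qed.

End VolumeAndKernel.

(** * Energy on the random graph *)

Section RandomEnergy.
Context {R : realType} {V : choiceType}.
Implicit Types (x y : V) (w : config V) (A : {fset V}) (f : V -> R).

Lemma open_graph_sym w : symmetric (open_graph w).
Proof. by move=> x y; rewrite /open_graph fsetUC. Qed.

Lemma open_graph_irrefl w : irreflexive (open_graph w).
Proof.
move=> x; rewrite /open_graph fsetUid insubF//.
by rewrite cardfs1.
Qed.

Lemma measurable_open_graph x y : measurable [set w | open_graph w x y].
Proof.
rewrite /open_graph; case: insubP => [a _ _|_]; last first.
  by rewrite (_ : [set w | _] = set0)//; apply/seteqP; split.
by apply: sub_sigma_algebra; exists a.
Qed.

Lemma energy_ge0 (c : V -> V -> R) f A :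
  (forall x y, 0 <= c x y) -> 0 <= energy c f A.
Proof.
move=> c_ge0; apply: sumr_ge0 => x _; apply: sumr_ge0 => y _.
by rewrite mulr_ge0 ?sqr_ge0.
Qed.

Lemma ler_energy (c c' : V -> V -> R) f A :
  (forall x y, c x y <= c' x y) -> energy c f A <= energy c' f A.
Proof.
move=> cc'; apply: ler_sum => x _; apply: ler_sum => y _.
by rewrite ler_wpM2r// sqr_ge0.
Qed.

Lemma energy_subset (c : V -> V -> R) f A B : (forall x y, 0 <= c x y) ->
  (A `<=` B)%fset -> energy c f A <= energy c f B.
Proof.
move=> c_ge0 AB.
have sub_sum (F : V -> R) : (forall x, 0 <= F x) ->
    \sum_(x <- A) F x <= \sum_(x <- B) F x.
  move=> F_ge0; pose G x := if x \in A then F x else 0.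
  rewrite (eq_big_seq G) => [|x xA]; last by rewrite /G xA.
  rewrite (big_fset_incl _ AB); last by move=> x _ /negPf xA; rewrite /G xA.
  by apply: ler_sum => x _; rewrite /G; case: ifP.
have term_ge0 x y : 0 <= c x y * (f x - f y) ^+ 2 by rewrite mulr_ge0 ?sqr_ge0.
apply: le_trans (sub_sum _ _) => [|x]; last exact: sumr_ge0.
by apply: ler_sum => x _; exact: sub_sum.
Qed.

Definition open_weight w x y : R := (open_graph w x y)%:R.

Variables (J : V -> V -> R) (beta : R) (P : probability (config V) R).
Hypotheses (J_ge0 : kernel_ge0 J) (beta_ge0 : 0 <= beta).
Hypothesis law : percolation_law J beta P.

Lemma open_probability_le x y :
  (P [set w | open_graph w x y] <= (beta * J x y)%:E)%E.
Proof.
have [->|xy] := eqVneq x y.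
  under eq_set do rewrite open_graph_irrefl.
  rewrite (_ : [set w | _] = set0) ?measure0 ?lee_fin ?mulr_ge0//.
  by apply/seteqP; split.
rewrite law.1// lee_fin lerBlDr -lerBlDl.
by have := expR_ge1Dx (- (beta * J x y)).
Qed.

Lemma measurable_open_weight x y : measurable_fun setT (fun w => open_weight w x y).
Proof.
rewrite (_ : (fun w => _) = \1_[set w | open_graph w x y]).
  exact: measurable_indic (measurable_open_graph x y).
by apply/funext => w; rewrite /open_weight indicE mem_setE.
Qed.

Lemma measurable_energy f A :
  measurable_fun setT (fun w => energy (open_weight w) f A).
Proof.
rewrite /energy; apply: measurable_sum => x; apply: measurable_sum => y.
by apply: measurable_funM; [exact: measurable_open_weight | exact: measurable_cst].
Qed.

Lemma expected_energy_le f A :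
  (\int[P]_w (energy (open_weight w) f A)%:E <= (beta * energy J f A)%:E)%E.
Proof.
pose g x y w : \bar R := (((f x - f y) ^+ 2)%:E * (open_weight w x y)%:E)%E.
have mw x y : measurable_fun setT (fun w => (open_weight w x y)%:E).
  by apply/measurable_EFinP; exact: measurable_open_weight.
have mg x y : measurable_fun setT (g x y) by apply: measurable_funeM.
have w_ge0 w x y : (0 <= (open_weight w x y)%:E)%E by rewrite lee_fin ler0n.
have f_ge0 x y : (0 <= ((f x - f y) ^+ 2)%:E)%E by rewrite lee_fin sqr_ge0.
have g_ge0 x y w : (0 <= g x y w)%E by rewrite mule_ge0.
rewrite (eq_integral (fun w => \sum_(x <- A) \sum_(y <- A) g x y w)%E); last first.
  move=> w _; rewrite /energy -sumEFin; apply: eq_bigr => x _.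
  by rewrite -sumEFin; apply: eq_bigr => y _; rewrite /g -EFinM mulrC.
rewrite ge0_integral_sum//; last first.
- by move=> x w _; apply: sume_ge0 => y _; exact: g_ge0.
- by move=> x; apply: emeasurable_sum => y; exact: mg.
rewrite /energy mulr_sumr -sumEFin; apply: lee_sum => x _.
rewrite ge0_integral_sum//.
rewrite mulr_sumr -sumEFin; apply: lee_sum => y _.
rewrite ge0_integralZl//.
have -> : (\int[P]_w (open_weight w x y)%:E = P [set w | open_graph w x y])%E.
  rewrite -[X in _ = P X]setIT -integral_indic//; last exact: measurable_open_graph.
  by apply: eq_integral => w _; rewrite /open_weight indicE mem_setE.
rewrite mulrA [leRHS]EFinM muleC.
by rewrite lee_wpmul2r// open_probability_le.
Qed.

(** If all the random energies were at least a, uniformly in n, then by Markov's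
inequality this event would have probability at most the expected energy of f_ n
divided by a, for every n, hence 0.  Continuity of the measure along the
exhaustion A_ replaces the energy over the whole graph, an infinite sum. *)
Lemma ae_small_energy (A_ : nat -> {fset V}) (f_ : nat -> V -> R) :
  (forall m n, (m <= n)%N -> (A_ m `<=` A_ n)%fset) ->
  (forall delta, 0 < delta -> exists n, forall m, energy J (f_ n) (A_ m) <= delta) ->
  {ae P, forall w, forall delta : R, 0 < delta ->
    exists n, forall m, energy (open_weight w) (f_ n) (A_ m) <= delta}.
Proof.
move=> A_nd E_small.
have w_ge0 w x y : 0 <= open_weight w x y by rewrite ler0n.
suff : {ae P, forall w, forall k,
    exists n, forall m, energy (open_weight w) (f_ n) (A_ m) <= k.+1%:R^-1}.
  apply: filterS => w H delta delta_gt0.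
  have [n Hn] := H (Num.truncn delta^-1); exists n => m; apply: le_trans (Hn m) _.
  by rewrite invf_ple ?posrE// ltW// truncnS_gt.
apply: ae_foralln => k; set a : R := k.+1%:R^-1.
have a_gt0 : 0 < a by rewrite invr_gt0.
pose B n m := [set w | a <= energy (open_weight w) (f_ n) (A_ m)].
have mB n m : measurable (B n m).
  rewrite (_ : B n m =
      setT `&` (fun w => energy (open_weight w) (f_ n) (A_ m)) @^-1` `[a, +oo[).
    exact: measurable_energy.
  by rewrite setTI; apply/seteqP; split => w /=; rewrite in_itv/= andbT.
have PB n m : (a%:E * P (B n m) <= (beta * energy J (f_ n) (A_ m))%:E)%E.
  apply: le_trans (expected_energy_le _ _).
  have := @le_integral_abse _ _ _ P setT measurableT
    (fun w => (energy (open_weight w) (f_ n) (A_ m))%:E) a.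
  rewrite setTI (_ : [set w | _] = B n m); last first.
    by apply/seteqP; split => w /=; rewrite lee_fin ger0_norm ?energy_ge0.
  rewrite [X in (_ <= X)%E](eq_integral (fun w => (energy (open_weight w) (f_ n) (A_ m))%:E)).
    by apply=> //; apply/measurable_EFinP; exact: measurable_energy.
  by move=> w _; rewrite gee0_abs// lee_fin energy_ge0.
(* N is the event that every energy reaches a on some A_ m. *)
pose N := \bigcap_n \bigcup_m B n m.
have mBU n : measurable (\bigcup_m B n m) by exact: bigcup_measurable.
have mN : measurable N by exact: bigcapT_measurable.
exists N; split => //.
- apply/eqP; rewrite eq_le measure_ge0 andbT; apply/lee_addgt0Pr => eps eps_gt0.
  rewrite add0e.
  have beta1_gt0 : 0 < beta + 1 by rewrite ltr_wpDl.
  have [n En] := E_small (a * eps / (beta + 1)) ltac:(by rewrite divr_gt0// mulr_gt0).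
  apply: (@le_trans _ _ (P (\bigcup_m B n m))).
    by apply: le_measure; rewrite ?inE//; exact: bigcap_inf.
  have cv : (P \o B n) x @[x --> \oo] --> P (\bigcup_m B n m).
    apply: nondecreasing_cvg_mu => // i j ij; apply/subsetPset => w /= /le_trans; apply.
    exact: energy_subset (A_nd _ _ ij).
  rewrite -(cvg_lim _ cv)//; apply: lime_le; first by apply/cvg_ex; eexists; exact: cv.
  apply: nearW => m /=.
  rewrite -(@lee_pmul2l _ a%:E)// ?lte_fin//.
  apply: le_trans (PB n m) _; rewrite -EFinM lee_fin.
  apply: (@le_trans _ _ (beta * (a * eps / (beta + 1)))); first by rewrite ler_wpM2l.
  rewrite mulrCA ler_piMr//; first by rewrite mulr_ge0// ltW.
  by rewrite ler_pdivrMr// mul1r lerDl.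
move=> w /= not_small n _; apply: contrapT => not_B; apply: not_small; exists n => m.
by rewrite leNgt; apply/negP => /ltW lt; apply: not_B; exists m.
Qed.

End RandomEnergy.

(** * Recurrence of the infinite clusters *)

Section Recurrence.
Context {R : realType} {V : choiceType}.

(** If v is not x, the last edge of a walk from x to v will do; otherwise take
the first edge of a walk from x to another vertex of the component. *)
Lemma component_neighbour (e : rel V) (x v : V) : symmetric e ->
  infinite_set (component e x) -> component e x v ->
  exists y, Defs.induced e (component e x) v y.
Proof.
move=> e_sym Cinf; set C := component e x => Cv.
have inC y p : path e x p -> last x p = y -> C y.
  by move=> xp lp; exists (size p), p.
have [n [p xp [lp _]]] := Cv; case/lastP: p xp lp => [|p v'].
  move=> _ /= xv; move: Cv; rewrite -xv => Cx.
  have [z Cz zx] : exists2 z, C z & z != x.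
    apply: contrapT => no_z; apply: Cinf; apply: (@sub_finite_set _ _ [set x]).
      by move=> z Cz; apply: contrapT => zx; apply: no_z; exists z => //; exact/eqP.
    exact: finite_set1.
  have [_ [[|a q] /= xq [lq _]]] := Cz; first by rewrite -lq eqxx in zx.
  move: xq => /andP[xa _]; exists a; rewrite /Defs.induced xa andbT.
  by apply/andP; split; apply: mem_set => //; apply: (inC a [:: a]) => //=; rewrite xa.
rewrite rcons_path last_rcons => /andP[xp pv] v'v; rewrite v'v in pv.
exists (last x p); rewrite /Defs.induced e_sym pv andbT.
by apply/andP; split; apply: mem_set => //; exact: inC xp _.
Qed.

(** Passing to the subgraph induced on a component only lowers energies. *)
Lemma recurrent_of_small_energy (e : rel V) (x : V) : symmetric e ->
  infinite_set (component e x) ->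
  (forall v (delta : R), 0 < delta -> exists (f : V -> R) (S : {fset V}),
    [/\ f v = 1, forall y, y \notin S -> f y = 0 &
        forall A, energy (fun y z => (e y z)%:R) f A <= delta]) ->
  recurrent_on R e (component e x).
Proof.
move=> e_sym Cinf small [v Cv]; apply: no_escape_of_small_energy.
- by move=> y z; rewrite /Defs.induced e_sym andbCA.
- exact: component_neighbour.
move=> delta /(small v)[f [S [fv fS E_le]]]; exists f, S; split=> // A.
apply: le_trans (E_le A); apply: ler_energy => y z.
by rewrite ler_nat /Defs.induced; case: (e y z); rewrite ?andbF ?leq_b1.
Qed.

End Recurrence.

Theorem theorem1p15 (R : realType) (V : choiceType) (e : rel V) (o : V)
    (J : V -> V -> R) (alpha : R) (P : R -> probability (config V) R)
    (beta : R) :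
  infinite_set [set: V] ->
  simple_graph e -> connected_graph e -> locally_finite e ->
  transitive_graph e -> growth_dimension R e o 2 ->
  kernel_ge0 J -> kernel_symmetric J -> kernel_transitive e J ->
  kernel_integrable o J ->
  2 <= alpha -> kernel_bigO e J (2 * alpha) ->
  (forall b : R, 0 <= b -> percolation_law J b (P b)) ->
  (critical_parameter P o < beta%:E)%E ->
  {ae P beta, forall w : config V, forall x : V,
    infinite_set (component (open_graph w) x) ->
    recurrent_on R (open_graph w) (component (open_graph w) x)}.
Proof.
move=> _ _ e_conn _ e_trans growth J_ge0 J_sym J_trans J_int alpha_ge2 J_O law.
(* All the parameters defining the critical one are nonnegative, so beta is too. *)
move=> /ereal_inf_lt[_ [b [b_ge0 _] <-]]; rewrite lte_fin => b_beta.
have beta_ge0 : 0 <= beta by exact: le_trans (ltW b_beta).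
have [C C_ge0 volume] := uniform_volume_bound e_trans growth.
have [K J_decay] : exists K : R, forall x y, J x y * (gdist e x y)%:R ^+ 4 <= K.
  by apply: kernel_polynomial_decay J_int J_O => //; lra.
pose A_ m := fset_set (gball e o m).
have inA m y : (y \in A_ m) = (gdist e o y <= m)%N.
  by rewrite in_fset_set; [apply/idP/idP; rewrite inE | exact: finite_gball growth].
have A_nd m n : (m <= n)%N -> (A_ m `<=` A_ n)%fset.
  by move=> mn; apply/fsubsetP => y; rewrite !inA => /leq_trans; apply.
pose f_ v n := loglog_cutoff (gdist e) v n.+1 : V -> R.
have E_small v delta : 0 < delta ->
    exists n, forall m, energy J (f_ v n) (A_ m) <= delta.
  move=> delta_gt0.
  have harm_nd : {homo series (@harmonic R) : m n / (m <= n)%N >-> m <= n}.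
    by apply/nondecreasing_seqP => n; rewrite seriesS lerDr harmonic_ge0.
  have /cvgryPge/(_ (512 * K * C ^+ 2 / delta)) :=
    nondecreasing_dvgn_lt harm_nd (@dvg_harmonic R).
  case=> n _ /(_ n.+1 (leqnSn n)) H_ge; exists n => m.
  apply: le_trans (energy_loglog_cutoff (gdist_triangle e_conn) C_ge0 volume
    J_ge0 J_sym J_decay v (A_ m) (ltn0Sn n)) _.
  have H_gt0 := @series_harmonic_gt0 R n.
  by rewrite ler_pdivrMr// [leRHS]mulrC -ler_pdivrMr.
(* Vertices are enumerated as the i-th element of the k-th ball, which turns
   the almost sure statement for all centres into a countable intersection. *)
have : {ae P beta, forall w, forall k i, forall delta : R, 0 < delta ->
    exists n, forall m,
      energy (open_weight w) (f_ (nth o (A_ k) i) n) (A_ m) <= delta}.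
  apply: ae_foralln => k; apply: ae_foralln => i.
  exact: (ae_small_energy J_ge0 beta_ge0 (law _ beta_ge0) A_nd (E_small _)).
apply: filterS => w small x Cinf; apply: recurrent_of_small_energy => //.
  exact: open_graph_sym.
move=> v delta delta_gt0.
have vA : v \in A_ (gdist e o v) by rewrite inA.
have [n E_le] := small (gdist e o v) (index v (A_ (gdist e o v))) delta delta_gt0.
rewrite nth_index// in E_le.
exists (f_ v n), (A_ (gdist e o v + 2 ^ n.+1)%N); split.
- rewrite /f_ /loglog_cutoff gdistxx divff// gt_eqF//.
  apply: lt_le_trans (weight_tail_log_growth n.+1).
  by rewrite divr_gt0// series_harmonic_gt0.
- move=> y; rewrite inA -ltnNge => far.
  rewrite /f_ /loglog_cutoff /weight_tail big_geq ?mul0r//.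
  have := leq_trans far (gdist_triangle e_conn o v y).
  by rewrite ltn_add2l => /ltnW.
move=> A; pose m := \max_(y <- A) gdist e o y.
apply: le_trans (E_le m); apply: energy_subset => [y z|]; first by rewrite ler0n.
by apply/fsubsetP => y yA; rewrite inA; apply: leq_bigmax_seq.
Qed.
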